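(* The set $\mathbb Q$ of rational numbers, canonically arranged as below, has size sequence $$\sigma(\mathbb Q)=2\,\sigma(\mathbb I)\cdot(\alpha+1)+1,\quad\text{i.e. } \sigma_n(\mathbb Q)=2(n+1)\Phi(n)+1,$$ where $\Phi(n)=\sum_{i=1}^n\varphi(i)$ with $\varphi$ Euler's totient function; moreover $\sigma(\mathbb Q)\approx_\mathcal F\alpha^3$, and more precisely $$\tfrac{3}{5}(\alpha^3+\alpha^2)<_\mathcal F\sigma(\mathbb Q)<_\mathcal F\alpha^3-\alpha.$$
   Context: $\mathbb N=\{1,2,\dots\}$. Positive rationals are represented by triples $(p,k,m)$, $p\in\mathbb N_0$, $k,m\in\mathbb N$, $\gcd(k,m)=1$, $k\le m$, standing for $p+k/m$; the triple lies in the $n$-th component of $\mathbb Q^+$ where $n=\max\{\ell(p),m\}$, with $\ell(0)=1$ and $\ell(p)=p$ for $p\ge1$ (this is the product arrangement of $\mathbb N_0\times\mathbb I$, $\mathbb I=(0,1]\cap\mathbb Q$). Negative rationals $\mathbb Q^-$ are arranged so that $-x$ lies in the same component as $x\in\mathbb Q^+$, and $0$ lies in the first component; $\mathbb Q=\mathbb Q^+\cup\mathbb Q^-\cup\{0\}$ is arranged by componentwise union. The size sequence is $\sigma(A)=(\sigma_n(A))_n$ with $\sigma_n(A)$ the number of elements of $A$ in components $1,\dots,n$. $\alpha=(n)_n$; operations on sequences are componentwise; constants are identified with constant sequences. $(a_n)<_\mathcal F(b_n)$ iff $a_n<b_n$ for all sufficiently large $n$; $(a_n)\approx_\mathcal F(b_n)$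 iff some $k\in\mathbb N$ has $ka_n\ge b_n$ for all large $n$ and some $k$ has $kb_n\ge a_n$ for all large $n$. *)

(* Defs.v *)
From mathcomp Require Import all_boot all_order all_algebra.
Set Implicit Arguments. Unset Strict Implicit. Unset Printing Implicit Defensive.
Import Order.TTheory GRing.Theory Num.Theory.
Local Open Scope ring_scope.

Definition Phi (n : nat) : nat := (\sum_(1 <= i < n.+1) totient i)%N.

Definition ell (p : nat) : nat := if p == 0%N then 1%N else p.

(* The triple (p,k,m) representing a positive rational x = p + k/m with
   gcd(k,m)=1, 0 < k <= m: p = ceil x - 1 and k/m = x - p in lowest terms. *)
Definition triple_p (x : rat) : nat := `|Num.ceil x - 1|%N.
Definition triple_k (x : rat) : nat := `|numq (x - (triple_p x)%:R)|%N.
Definition triple_m (x : rat) : nat := `|denq (x - (triple_p x)%:R)|%N.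

(* component of a positive rational in the product arrangement of N0 x I *)
Definition comp_pos (x : rat) : nat := maxn (ell (triple_p x)) (triple_m x).

Definition compQ (x : rat) : nat :=
  if x == 0 then 1%N else comp_pos `|x|.

Definition compI (x : rat) : nat := `|denq x|%N.
Definition inI (x : rat) : bool := (0 < x) && (x <= 1).

Definition has_card (A : pred rat) (c : nat) : Prop :=
  exists s : seq rat, [/\ uniq s, forall x, (x \in s) = A x & size s = c].

Definition eventually (P : nat -> Prop) : Prop :=
  exists N : nat, forall n, (N <= n)%N -> P n.

(* Main.v *)
Require Import Defs.
From mathcomp Require Import all_boot all_order all_algebra cyclic.
From mathcomp Require Import zify ring lra.
Set Implicit Arguments. Unset Strict Implicit. Unset Printing Implicit Defensive.
Import Order.TTheory GRing.Theory Num.Theory.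

(** The counts are explicit enumerations by fractions and by p + y with y in
    (0, 1].  The delicate point of the asymptotics is
    Phi(n) >= 3 n^2 / 10 for large n, the limit of Phi(n) / n^2 being
    3 / pi^2 = 0.3039...  Summing Gauss' identity and sieving by 2 and 3 gives
      sum of Phi(n/d) over d coprime to 6 = T(n) - T(n/2) - T(n/3) + T(n/6)
                                          = n^2 / 3 + O(n),
    with T(n) = n (n + 1) / 2.  Dropping the terms d > 1 bounds Phi(m) by
    essentially m^2 / 3; inserting this bound into those terms yields
      Phi(n) >= (1 - s) n^2 / 3 - O(n),
    where s, the sum of 1/d^2 over d > 1 coprime to 6, is less than 1/10. *)

(** * Divisor sums of [Phi], sieved by 2 and 3 *)

Lemma PhiS n : Phi n.+1 = (Phi n + totient n.+1)%N.
Proof. by rewrite /Phi big_nat_recr. Qed.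

Lemma sum_dvdn (F : nat -> nat) d n : (0 < d)%N ->
  (\sum_(1 <= m < n.+1 | d %| m) F m = \sum_(1 <= e < (n %/ d).+1) F (d * e))%N.
Proof.
move=> d0; elim: n => [|n IH]; first by rewrite div0n !big_geq.
rewrite big_mkcond big_nat_recr //= -big_mkcond IH divnS //.
case: ifP => dn; last by rewrite add0n addn0.
rewrite add1n [RHS]big_nat_recr //=; congr (_ + F _)%N.
have : (n.+1 %/ d = (n %/ d).+1)%N by rewrite divnS // dn.
by move=> <-; rewrite mulnC divnK.
Qed.

(** Both sides add [totient e] over all pairs with d * e <= n; grouping the pairs by m = d * e,
    Gauss' identity collapses each group to m. *)
Lemma sum_Phi_div n :
  (\sum_(1 <= d < n.+1) Phi (n %/ d) = \sum_(1 <= m < n.+1) m)%N.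
Proof.
transitivity (\sum_(1 <= d < n.+1)
    \sum_(1 <= e < n.+1 | (e <= n %/ d)%N) totient e)%N.
  rewrite big_nat [RHS]big_nat; apply: eq_bigr => d /andP[d1 _].
  by rewrite /Phi (big_nat_widen _ _ n.+1) // ltnS leq_div.
transitivity (\sum_(1 <= m < n.+1)
    \sum_(1 <= e < n.+1 | e %| m) totient e)%N; last first.
  rewrite big_nat [RHS]big_nat; apply: eq_bigr => m /andP[m1 mn].
  rewrite -{2}(sum_totient_dvd m) -(big_mkord (fun d => d %| m) totient).
  rewrite [RHS]big_ltn_cond // dvd0n (gtn_eqF m1).
  rewrite [RHS](big_nat_widen _ _ n.+1) //; apply: eq_bigl => e.
  by rewrite ltnS; case: (boolP (e %| m)) => // /(dvdn_leq m1) ->.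
rewrite (exchange_big_dep_nat xpredT) //= [RHS](exchange_big_dep_nat xpredT) //=.
rewrite big_nat [RHS]big_nat; apply: eq_bigr => e /andP[e1 en].
rewrite (sum_dvdn (fun=> totient e)) // [RHS](big_nat_widen _ _ n.+1) //; last first.
  by rewrite ltnS leq_div.
rewrite big_nat_cond [RHS]big_nat_cond; apply: eq_bigl => d.
case: (posnP d) => [->|d1] //=.
by rewrite !ltnS !leq_divRL // mulnC.
Qed.

(** Inclusion-exclusion for the primes 2 and 3, with the negative terms moved across so that no
    truncated subtraction occurs. *)
Lemma sum_coprime6 (F : nat -> nat) n :
  (\sum_(1 <= d < n.+1) F d + \sum_(1 <= d < n.+1 | 6 %| d) F d =
   \sum_(1 <= d < n.+1 | 2 %| d) F d + \sum_(1 <= d < n.+1 | 3 %| d) F d +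
   \sum_(1 <= d < n.+1 | coprime d 6) F d)%N.
Proof.
rewrite !(big_mkcond (fun d => _ %| _)) (big_mkcond (fun d => coprime _ _)).
rewrite -!big_split; apply: eq_bigr => d _ /=.
rewrite (coprimeMr d 2 3) !(coprime_sym d) !prime_coprime //.
rewrite (@Gauss_dvd 2 3) //.
by case: (2 %| d); case: (3 %| d); rewrite /= ?addn0 ?add0n.
Qed.

Definition triangle (n : nat) : nat := \sum_(1 <= m < n.+1) m.

Lemma triangleE n : (triangle n * 2 = n * n.+1)%N.
Proof.
elim: n => [|n IH]; first by rewrite /triangle big_geq.
by rewrite /triangle big_nat_recr //= mulnDl IH; lia.
Qed.

Lemma sum_Phi_div_dvdn k n : (0 < k)%N ->
  (\sum_(1 <= d < n.+1 | k %| d) Phi (n %/ d) = triangle (n %/ k))%N.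
Proof.
move=> k0; rewrite (sum_dvdn (fun d => Phi (n %/ d))) //.
by under eq_bigr do rewrite divnMA; rewrite sum_Phi_div.
Qed.

Lemma sum_Phi_coprime6 n :
  (triangle n + triangle (n %/ 6) = triangle (n %/ 2) + triangle (n %/ 3) +
   \sum_(1 <= d < n.+1 | coprime d 6) Phi (n %/ d))%N.
Proof.
by rewrite -!sum_Phi_div_dvdn // -sum_coprime6 [in LHS]/triangle -sum_Phi_div.
Qed.

(** The leading coefficient is (1 - 1/4)(1 - 1/9) / 2 = 1/3; the linear slack pays for the
    floors. *)
Lemma sum_Phi_coprime6_bounds n :
  let S := (\sum_(1 <= d < n.+1 | coprime d 6) Phi (n %/ d))%N in
  (n ^ 2 <= 3 * S + 4 * n + 10)%N /\ (3 * S <= n ^ 2 + 4 * n + 10)%N.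
Proof.
move=> S.
have := triangleE n; have := triangleE (n %/ 2); have := triangleE (n %/ 3).
have := triangleE (n %/ 6); have := sum_Phi_coprime6 n; rewrite -/S.
have := divn_eq n 6; have : (n %% 6 < 6)%N by rewrite ltn_mod.
move: (n %/ 6)%N (n %% 6)%N => q r r6 nE.
(* The residue r mod 6 fixes what it contributes to n/2 and n/3, so each of the six cases is
   polynomial in q. *)
have [r2 [r3 [E2 E3 B]]] : exists r2 r3, [/\ (n %/ 2 = 3 * q + r2)%N,
   (n %/ 3 = 2 * q + r3)%N & [|| (r == 0) && (r2 == 0) && (r3 == 0),
   (r == 1) && (r2 == 0) && (r3 == 0), (r == 2) && (r2 == 1) && (r3 == 0),
   (r == 3) && (r2 == 1) && (r3 == 1), (r == 4) && (r2 == 2) && (r3 == 1)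
   | (r == 5) && (r2 == 2) && (r3 == 1)]]%N.
  by exists (r %/ 2)%N, (r %/ 3)%N; split; lia.
rewrite E2 E3 nE; move: (triangle _) (triangle _) (triangle _) (triangle _).
by move=> a b c d; case/or3P: B => [| |/or4P[]] /andP[/andP[/eqP-> /eqP->] /eqP->]; nia.
Qed.

(** * Inverse squares of the integers coprime to 6 *)

Local Open Scope ring_scope.

(** The left side is close to 1/(18 x^2), while the right side equals 1/(18 (x^2 - 1/4)). *)
Lemma inv_sqr_pair_le (R : realFieldType) (x : R) : 1 <= x ->
  (6 * x - 1) ^- 2 + (6 * x + 1) ^- 2
    <= (18 * (x - 2^-1))^-1 - (18 * (x + 2^-1))^-1.
Proof.
move=> x1; rewrite -subr_ge0.
suff -> : (18 * (x - 2^-1))^-1 - (18 * (x + 2^-1))^-1 -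
    ((6 * x - 1) ^- 2 + (6 * x + 1) ^- 2) =
    (216 * x ^+ 2 + 10) /
    (((18 * (x - 2^-1)) * (x + 2^-1)) * ((6 * x - 1) ^+ 2 * (6 * x + 1) ^+ 2)).
  apply: divr_ge0; first by nra.
  by rewrite mulr_ge0 // mulr_ge0 ?sqr_ge0 //; lra.
by field; apply/and4P; split; lra.
Qed.

(* Consecutive coprime residues pair up as 6k - 1 and 6k + 1, and
   [inv_sqr_pair_le] telescopes. *)
Lemma sum_inv_sqr_coprime6_block (R : realFieldType) k :
  \sum_(2 <= d < 6 * k + 14 | coprime d 6) (d%:R : R) ^- 2
    <= 31 / 320 - (18 * (k%:R + 5 / 2))^-1.
Proof.
elim: k => [|k IH].
  (* The terms here are d = 5, 7, 11, 13. The constant [31 / 320] lies just above their sum plus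
     1/45, and below 1/10. *)
  rewrite muln0 add0n /= !big_cons big_nil /= -!exprVn.
  have -> : (18 * (0 + 5 / 2))^-1 = 45^-1 :> R by field.
  lra.
rewrite (_ : 6 * k.+1 + 14 = (6 * k + 14).+4.+2)%N; last by lia.
have E (b : nat) c : coprime b 6 = c -> coprime (6 * k + b) 6 = c.
  by move=> <-; rewrite mulnC /coprime gcdnC gcdnMDl gcdnC.
have K2 b : (2 <= (6 * k + b.+2))%N by lia.
(* Of the six new indices only 6k + 17 and 6k + 19 are coprime to 6; they surround 6 (k + 3). *)
have -> : \sum_(2 <= d < (6 * k + 14).+4.+2 | coprime d 6) (d%:R : R) ^- 2 =
    \sum_(2 <= d < 6 * k + 14 | coprime d 6) (d%:R : R) ^- 2 +
    ((6 * (k%:R + 3) - 1) ^- 2 + (6 * (k%:R + 3) + 1) ^- 2).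
  rewrite big_mkcond !big_nat_recr ?leqW -?big_mkcond //; try lia.
  rewrite -!addnS (E 14 false) // (E 15 false) // (E 16 false) // (E 17 true) //.
  rewrite (E 18 false) // (E 19 true) // !Monoid.mulm1 -Monoid.mulmA.
  congr (_ + (_ ^- 2 + _ ^- 2)); rewrite natrD natrM; ring.
have k0 : 0 <= k%:R :> R by rewrite ler0n.
have x1 : 1 <= k%:R + 3 :> R by lra.
have := inv_sqr_pair_le x1.
have -> : k%:R + 3 - 2^-1 = k%:R + 5 / 2 :> R by field.
have -> : k%:R + 3 + 2^-1 = k.+1%:R + 5 / 2 :> R by rewrite -addn1 natrD; field.
move=> h; have := lerD IH h.
by rewrite [X in _ <= X]addrA subrK.
Qed.

Lemma sum_inv_sqr_coprime6_le (R : realFieldType) n :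
  \sum_(2 <= d < n.+1 | coprime d 6) (d%:R : R) ^- 2 <= 31 / 320.
Proof.
case: n => [|n]; first by rewrite big_geq // divr_ge0.
apply: (@le_trans _ _ (31 / 320 - (18 * (n.+1%:R + 5 / 2))^-1)).
  apply: le_trans (sum_inv_sqr_coprime6_block _ n.+1).
  rewrite [leRHS](big_cat_nat (n := n.+2)) /=; try lia.
  rewrite lerDl sumr_ge0 // => d _; rewrite invr_ge0 exprn_ge0 //.
by rewrite gerBl invr_ge0 mulr_ge0 // addr_ge0 // divr_ge0.
Qed.

(** * Quadratic bounds for [Phi] *)

Lemma Phi_le (R : realFieldType) n : (Phi n)%:R <= 67 / 200 * n%:R ^+ 2 + 271 :> R.
Proof.
case: n => [|n]; first by rewrite /Phi big_geq // expr0n mulr0 add0r.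
have [_] /= := sum_Phi_coprime6_bounds n.+1.
rewrite big_ltn_cond // coprime1n divn1.
set X := Phi _; set Y := (\sum_(_ <= _ < _ | _) _)%N.
move=> h; have {h} : (3 * X <= n.+1 ^ 2 + 4 * n.+1 + 10)%N by lia.
rewrite -(ler_nat R) !natrD natrX !natrM; move: (n.+1)%:R (X%:R) => x y h.
(* Since 67/200 - 1/3 = 1/600, completing the square in x^2/600 - 4x/3 gives (x - 400)^2/600 -
   800/3; adding 10/3 makes the constant 270. *)
have := sqr_ge0 (x - 400); nra.
Qed.

Lemma divn_natr_le (R : realFieldType) m d : (m %/ d)%:R <= m%:R / d%:R :> R.
Proof.
case: (posnP d) => [->|d0]; first by rewrite divn0 invr0 mulr0.
by rewrite ler_pdivlMr ?ltr0n // -natrM ler_nat leq_divM.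
Qed.

Lemma Phi_ge (R : realFieldType) n : (1000 ^ 2 <= n)%N -> 3 / 10 * n%:R ^+ 2 <= (Phi n)%:R :> R.
Proof.
move=> nN; have n0 : (0 < n)%N by apply: leq_trans nN; rewrite expn_gt0.
have [+ _] := sum_Phi_coprime6_bounds n.
rewrite big_ltn_cond // coprime1n divn1.
set Y := (\sum_(_ <= _ < _ | _) _)%N => h.
have hY : Y%:R <= (67 / 200 * n%:R ^+ 2) * (31 / 320) + 271 * n%:R :> R.
  rewrite /Y natr_sum.
  apply: (@le_trans _ _ (\sum_(2 <= d < n.+1 | coprime d 6)
     (67 / 200 * n%:R ^+ 2 * d%:R ^- 2 + 271))).
    apply: ler_sum => d _; apply: le_trans (Phi_le _ _) _.
    rewrite lerD2r -[leRHS]mulrA ler_wpM2l ?divr_ge0 // -exprVn -exprMn.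
    by rewrite lerXn2r ?nnegrE ?divr_ge0 // divn_natr_le.
  rewrite big_split /= -mulr_sumr; apply: lerD.
    by rewrite ler_wpM2l ?sum_inv_sqr_coprime6_le // mulr_ge0 ?exprn_ge0 ?divr_ge0.
  (* The error in [Phi_le] is constant, so it costs at most 271 n in total; an error linear in n/d
     would cost order n log n. *)
  apply: (@le_trans _ _ (\sum_(2 <= d < n.+1) 271)).
    by rewrite big_mkcond ler_sum // => d _; case: ifP.
  by rewrite sumr_const_nat -[leLHS]mulr_natr ler_pM2l // ler_nat; lia.
have hn : 1000 ^+ 2 <= n%:R :> R by rewrite -natrX ler_nat.
move: h; rewrite -(ler_nat R) !natrD natrX.
move: (n%:R : R) (Y%:R : R) ((Phi n)%:R : R) hn hY => x y z hn hY h.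
(* The coefficient 1/3 - (67/200)(31/320) exceeds 0.3008; from n = 10^6 on, its margin over 3/10
   beats the linear error. *)
nra.
Qed.

Lemma totient_le n : (1 < n)%N -> (totient n <= n.-1)%N.
Proof.
case: n => // n n1; rewrite totient_count_coprime big_ltn // /coprime gcdn0.
rewrite gtn_eqF // add0n; apply: leq_trans (_ : \sum_(1 <= d < n.+1) 1 <= _)%N.
  by apply: leq_sum => d _; apply: leq_b1.
by rewrite sum_nat_const_nat muln1 subn1.
Qed.

(* The slack comes from totient 4 = 2 and totient 6 = 2. *)
Lemma Phi_lt n : (6 <= n)%N -> (2 * Phi n + n + 6 <= n ^ 2)%N.
Proof.
elim: n => // n IH; rewrite leq_eqVlt => /predU1P[<-|n6].
  by rewrite /Phi unlock.
have n1 : (1 < n.+1)%N by lia.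
by rewrite PhiS; have := totient_le n1; have := IH n6; lia.
Qed.

(** * Counting rationals by component *)

Lemma eq_has_card (A B : pred rat) c : A =1 B -> has_card A c -> has_card B c.
Proof. by move=> AB [s [us sA sc]]; exists s; split=> // x; rewrite sA AB. Qed.

Lemma has_card_inj (A : pred rat) c c' : has_card A c -> has_card A c' -> c = c'.
Proof.
move=> [s [us sA <-]] [t [ut tA <-]]; apply: perm_size.
by apply: uniq_perm => // x; rewrite sA tA.
Qed.

Lemma has_cardU (A B : pred rat) a b : (forall x, A x -> ~~ B x) ->
  has_card A a -> has_card B b -> has_card (fun x => A x || B x) (a + b).
Proof.
move=> AB [s [us sA <-]] [t [ut tB <-]]; exists (s ++ t); split.
- rewrite cat_uniq us ut andbT; apply/hasPn => x /=; rewrite tB sA => Bx.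
  by apply/negP => /AB; rewrite Bx.
- by move=> x; rewrite mem_cat sA tB.
- by rewrite size_cat.
Qed.

Lemma denq_frac (k m : nat) : (0 < m)%N -> coprime k m ->
  denq (k%:R / m%:R) = m.
Proof.
move=> m0 km; rewrite (_ : k%:R / m%:R = k%:Z%:~R / m%:Z%:~R) //.
by rewrite coprimeq_den //=; case: m m0 km.
Qed.

Lemma has_card_unit_denq m : (0 < m)%N ->
  has_card (fun x => inI x && (compI x == m)%N) (totient m).
Proof.
move=> m0; have mR : 0 < m%:R :> rat by rewrite ltr0n.
exists [seq k%:R / m%:R | k <- [seq k <- iota 1 m | coprime k m]]; split.
- rewrite map_inj_uniq ?filter_uniq ?iota_uniq // => k l.
  move=> /(congr1 ( *%R^~ m%:R)); rewrite !divfK ?gt_eqF // => /eqP.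
  by rewrite eqr_nat => /eqP.
- move=> x; apply/mapP/andP => [[k + ->]|[/andP[x0 x1] /eqP xm]].
    rewrite mem_filter mem_iota add1n ltnS => /and3P[km k1 lkm].
    rewrite /inI /compI denq_frac //; split=> //.
    by rewrite divr_gt0 ?ltr0n // ler_pdivrMr // mul1r ler_nat.
  have xE : x = `|numq x|%N%:R / m%:R.
    rewrite -{1}[x]divq_num_den -xm /compI !natr_absz !ger0_norm ?denq_ge0 //.
    by rewrite numq_ge0 ltW.
  exists `|numq x|%N => //; rewrite mem_filter mem_iota add1n ltnS.
  rewrite -[X in coprime _ X]xm coprime_num_den /=.
  move: x0 x1; rewrite {1 2}xE ler_pdivrMr // mul1r ler_nat.
  by rewrite pmulr_lgt0 ?invr_gt0 // ltr0n => -> ->.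
(* The numerators run over 1..m, the totient count over 0..m-1; the endpoints 0 and m have the same
   gcd with m. *)
- rewrite size_map size_filter -sum1_count big_mkcond /= totient_count_coprime.
  have -> : iota 1 m = index_iota 1 m.+1 by rewrite /index_iota subn1.
  case: m m0 {mR} => // m _.
  rewrite big_nat_recr //= [RHS]big_ltn //= /coprime gcdnn gcdn0 addnC.
  by congr addn; apply: eq_bigr => d _; rewrite gcdnC; case: (_ == _).
Qed.

Lemma has_card_unit n : has_card (fun x => inI x && (compI x <= n)%N) (Phi n).
Proof.
elim: n => [|n IH].
  exists [::]; split=> [//|x|]; last by rewrite /Phi big_geq.
  by rewrite /compI leqn0 absz_eq0 denq_eq0 andbF.
rewrite PhiS; apply: eq_has_card (has_cardU _ IH (@has_card_unit_denq n.+1 isT)).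
  by move=> x; rewrite -andb_orr (leq_eqVlt _ n.+1) ltnS orbC.
move=> x /andP[_ xn]; rewrite negb_and; apply/orP; right.
by apply: contraTneq xn => ->; rewrite ltnn.
Qed.

(** As y lies in (0, 1], the ceiling of p + y is p + 1. This makes the decomposition unique. *)
Lemma triple_pE (p : nat) (y : rat) : inI y -> triple_p (p%:R + y) = p.
Proof.
move=> /andP[y0 y1]; rewrite /triple_p (@ceil_def _ _ (p%:Z + 1)) ?addrK //.
by rewrite rmorphD /= ltrDl y0 lerD2l.
Qed.

Lemma triple_p_frac (x : rat) : 0 < x -> inI (x - (triple_p x)%:R).
Proof.
move=> x0; have c1 : 0 <= Num.ceil x - 1 by rewrite subr_ge0 -gtz0_ge1 ceil_gt0.
rewrite /inI /triple_p natr_absz ger0_norm // subr_gt0 lerBlDr.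
have /andP[-> ] := ceil_itv x; by rewrite rmorphB /= addrC subrK.
Qed.

(** [ell] differs from the identity only at 0, and both 0 and 1 are at most a positive n. So p
    ranges over the n + 1 values 0..n. *)
Lemma ell_le p n : (0 < n)%N -> (ell p <= n)%N = (p <= n)%N.
Proof. by rewrite /ell; case: eqP => // ->. Qed.

(** A maximum is at most n iff both entries are, so the count is a product over p and the fractional
    part. *)
Lemma has_card_pos n : (0 < n)%N ->
  has_card (fun x => (0 < x) && (compQ x <= n)%N) (n.+1 * Phi n).
Proof.
move=> n0; have [s [us sI <-]] := has_card_unit n.
exists [seq p%:R + y | p <- iota 0 n.+1, y <- s]; split.
- apply: allpairs_uniq; rewrite ?iota_uniq // => -[p y] [q z].
  move=> /allpairsP[[? ?] [_ + [-> ->]]] /allpairsP[[? ?] [_ + [-> ->]]].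
  rewrite !sI => /andP[yI _] /andP[zI _] /= E.
  have pq := congr1 triple_p E; rewrite !triple_pE // in pq.
  by move: E; rewrite pq => /addrI ->.
- move=> x; apply/allpairsP/andP => [[[p y] [+ + ->]]|[x0 xn]].
    rewrite mem_iota sI add0n ltnS /= => pn /andP[yI yn].
    have y0 : 0 < p%:R + y by case/andP: yI => y0 _; rewrite ltr_wpDl.
    split=> //; rewrite /compQ gt_eqF // gtr0_norm // /comp_pos /triple_m.
    by rewrite triple_pE // geq_max ell_le // pn addrC addKr.
  exists (triple_p x, x - (triple_p x)%:R).
  move: xn; rewrite /compQ gt_eqF // gtr0_norm // /comp_pos geq_max ell_le //.
  rewrite mem_iota add0n ltnS /= sI triple_p_frac //= => /andP[-> ->].
  by split=> //; rewrite addrC subrK.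
- by rewrite size_allpairs size_iota.
Qed.

Lemma has_card_opp (A : pred rat) c :
  has_card A c -> has_card (fun x => A (- x)) c.
Proof.
move=> [s [us sA <-]]; exists [seq - x | x <- s]; split.
- by rewrite map_inj_uniq //; apply: oppr_inj.
- by move=> x; rewrite -sA -{1}[x]opprK mem_map //; apply: oppr_inj.
- by rewrite size_map.
Qed.

Lemma compQN x : compQ (- x) = compQ x.
Proof. by rewrite /compQ oppr_eq0 normrN. Qed.

Lemma has_card_rat n : (0 < n)%N ->
  has_card (fun x => (compQ x <= n)%N) (2 * (n + 1) * Phi n + 1).
Proof.
move=> n0; have Hp := has_card_pos n0; have Hn := has_card_opp Hp.
have H0 : has_card (fun x => x == 0) 1.
  by exists [:: 0]; split=> // x; rewrite inE.
rewrite (_ : 2 * (n + 1) * Phi n + 1 = n.+1 * Phi n + n.+1 * Phi n + 1)%N; last by lia.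
apply: eq_has_card (has_cardU _ (has_cardU _ Hp Hn) H0) => x.
(* At x = 0 the component is 1, which is at most n by [n0]. *)
- rewrite compQN oppr_gt0 -andb_orl; case: ltgtP => [_|_|<-] /=; rewrite ?orbF //.
- by apply: contraL => /eqP ->; rewrite oppr0 ltxx.
- by move=> /andP[x0 _]; rewrite oppr_gt0 negb_and -leNgt ltW.
Qed.

Theorem theorem12 :
  (* sigma_n(I) = Phi(n) *)
  (forall n : nat, (0 < n)%N ->
     has_card (fun x => inI x && (compI x <= n)%N) (Phi n)) /\
  (* sigma_n(Q) = 2 (n+1) Phi(n) + 1 *)
  (forall n : nat, (0 < n)%N ->
     has_card (fun x => (compQ x <= n)%N) (2 * (n + 1) * Phi n + 1)%N) /\
  (* asymptotics of the size sequence sigma(Q) *)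
  (forall sigma : nat -> nat,
     (forall n : nat, (0 < n)%N -> has_card (fun x => (compQ x <= n)%N) (sigma n)) ->
     [/\ (exists k : nat, (0 < k)%N /\ eventually (fun n => (n ^ 3 <= k * sigma n)%N)),
         (exists k : nat, (0 < k)%N /\ eventually (fun n => (sigma n <= k * n ^ 3)%N)),
         eventually (fun n => (3%:R / 5%:R) * ((n%:R : rat) ^+ 3 + (n%:R : rat) ^+ 2)
                              < (sigma n)%:R)
       & eventually (fun n => (sigma n)%:R < (n%:R : rat) ^+ 3 - n%:R)]).
Proof.
split=> [n _|]; first exact: has_card_unit.
split=> [|sigma sigmaP]; first exact: has_card_rat.
have sigmaE n : (0 < n)%N -> sigma n = (2 * (n + 1) * Phi n + 1)%N.
  by move=> n0; apply: has_card_inj (sigmaP n n0) (has_card_rat n0).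
(* The left side is 2 (n + 1) times the bound 3 n^2 / 10 on [Phi n]; the final + 1 makes the
   inequality strict. *)
have lower : eventually (fun n =>
    (3%:R / 5%:R) * ((n%:R : rat) ^+ 3 + (n%:R : rat) ^+ 2) < (sigma n)%:R).
  exists (1000 ^ 2)%N => n nN.
  have n0 : (0 < n)%N by apply: leq_trans nN; rewrite expn_gt0.
  rewrite sigmaE // natrD !natrM natrD; have := Phi_ge rat nN.
  have : 0 <= n%:R :> rat by rewrite ler0n.
  by move: n%:R (Phi n)%:R => x y; nra.
have upper : eventually (fun n => (sigma n < n ^ 3 - n)%N).
  (* Here (n + 1)(n^2 - n) = n^3 - n, and the 6 in [Phi_lt] leaves 6 (n + 1) to absorb the + 1. *)
  by exists 6%N => n n6; rewrite sigmaE; have := Phi_lt n6; nia.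
split=> //.
(* The factor 2 suffices because 2 * 3/5 > 1. *)
- exists 2%N; split=> //; case: lower => N lower; exists N => n /lower.
  rewrite -(ler_nat rat) natrM natrX => h.
  have : 0 <= (n%:R : rat) ^+ 2 by rewrite sqr_ge0.
  have : 0 <= (n%:R : rat) ^+ 3 by rewrite exprn_ge0.
  lra.
- exists 1%N; split=> //; case: upper => N upper; exists N => n /upper.
  by rewrite mul1n; lia.
- case: upper => N upper; exists N => n /upper h.
  by rewrite ltrBrDr -natrX -natrD ltr_nat; lia.
Qed.
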